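(* Let $L=\{x\in\{0,1\}^* : x \text{ contains an even number of } 1\text{s}\}$ be the parity language. Then $L$ is recognizable by a completely uniform transformer with $3$ layers. That is, there exist $d\in\mathbb{N}$, three attention layers $A_1,A_2,A_3$ of dimension $d$, a letter embedding $\ell\colon\{0,1\}\to\mathbb{R}^d$ and a position encoding $p\colon\mathbb{N}\to\mathbb{R}^d$ such that for every $n\in\mathbb{N}$ and every $x=x_1x_2\ldots x_n\in\{0,1\}^n$, setting $f_i=\ell(x_i)+p(i)$ for $i=1,\ldots,n$ and $(g_1,\ldots,g_n)=A_3\circ A_2\circ A_1(f_1,\ldots,f_n)$, the first coordinate $g_1^1$ of $g_1$ satisfies $g_1^1>0$ if $x\in L$, and $g_1^1<0$ if $x\notin L$.
   Context: Here $\mathbb{N}=\{1,2,3,\ldots\}$, so input words are non-empty. An attention layer of dimension $d$ is a length-preserving function $A\colon(\mathbb{R}^d)^*\to(\mathbb{R}^d)^*$ (where $(\mathbb{R}^d)^*$ is the set of finite sequences of vectors of $\mathbb{R}^d$) given by three matrices $K,Q,O\in\mathbb{R}^{d\times d}$ and a neural network $\mathcal{N}\colon\mathbb{R}^d\to\mathbb{R}^d$ with ReLU activation (a finite feed-forward network: a composition of finitely many affine maps between finite-dimensional real spaces, with coordinatewise $t\mapsto\max\{t,0\}$ applied between consecutive affine maps). On input $(f_1,\ldots,f_n)\in(\mathbb{R}^d)^n$, the output is computed as follows. First define $$a_i=\frac{\sum_{j=1}^n e^{\langle Kf_j,\,Qf_i\rangle}f_j}{\sum_{j=1}^n e^{\langle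 Kf_j,\,Qf_i\rangle}},\qquad i=1,\ldots,n,$$ and then set $$A(f_1,\ldots,f_n)_i=\mathcal{N}(f_i+Oa_i),\qquad i=1,\ldots,n.$$ The parameters $d$, $K$, $Q$, $O$, $\mathcal{N}$ of each layer, the letter embedding $\ell$ and the position encoding $p$ do not depend on the input length $n$. For a vector $g\in\mathbb{R}^d$, $g^1$ denotes its first coordinate. A language $L\subseteq\{0,1\}^*$ is recognizable by a completely uniform transformer with $C$ layers if there exist $d\in\mathbb{N}$, $C$ attention layers $A_1,\ldots,A_C$ of dimension $d$, a letter embedding $\ell\colon\{0,1\}\to\mathbb{R}^d$ and a position encoding $p\colon\mathbb{N}\to\mathbb{R}^d$ such that for any $n\in\mathbb{N}$ and any $x=x_1\ldots x_n\in\{0,1\}^n$, with $f_i=\ell(x_i)+p(i)$ and $(g_1,\ldots,g_n)=A_C\circ\cdots\circ A_1(f_1,\ldots,f_n)$, one has $g_1^1>0$ if $x\in L$ and $g_1^1<0$ if $x\notin L$. *)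

(* Defs.v *)
From mathcomp Require Import all_boot all_order all_algebra.
From mathcomp Require Import classical_sets reals topology normedtype sequences exp.

Set Implicit Arguments.
Unset Strict Implicit.
Unset Printing Implicit Defensive.

Import Order.TTheory GRing.Theory Num.Theory.
Local Open Scope ring_scope.

Definition dot (R : realType) (d : nat) (u v : 'cV[R]_d) : R :=
  \sum_(k < d) u k 0 * v k 0.

(* There is no activation after the last affine map. *)
Inductive relu_net (R : realType) : nat -> nat -> Type :=
| NetAffine m n of 'M[R]_(n, m) & 'cV[R]_n : relu_net R m n
| NetLayer m k n of 'M[R]_(k, m) & 'cV[R]_k & relu_net R k n :
    relu_net R m n.

Definition relu (R : realType) (n : nat) (v : 'cV[R]_n) : 'cV[R]_n :=
  map_mx (fun t => Num.max t 0) v.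

Fixpoint net_eval (R : realType) (m n : nat) (N : relu_net R m n) :
    'cV[R]_m -> 'cV[R]_n :=
  match N in relu_net _ m n return 'cV[R]_m -> 'cV[R]_n with
  | NetAffine _ _ W b => fun v => W *m v + b
  | NetLayer _ _ _ W b N' => fun v => net_eval N' (relu (W *m v + b))
  end.

Record attention_layer (R : realType) (d : nat) := AttentionLayer {
  key_mx : 'M[R]_d;
  query_mx : 'M[R]_d;
  output_mx : 'M[R]_d;
  layer_net : relu_net R d d }.

Section Attention.
Variables (R : realType) (d : nat) (A : attention_layer R d).

Definition attention_weight (u v : 'cV[R]_d) : R :=
  expR (dot (key_mx A *m v) (query_mx A *m u)).

Definition attention (s : seq 'cV[R]_d) (u : 'cV[R]_d) : 'cV[R]_d :=
  (\sum_(v <- s) attention_weight u v)^-1 *: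
    \sum_(v <- s) attention_weight u v *: v.

Definition layer_eval (s : seq 'cV[R]_d) : seq 'cV[R]_d :=
  [seq net_eval (layer_net A) (u + output_mx A *m attention s u) | u <- s].

End Attention.

(* The letter at 0-based index i has position i.+1, so p 0 is never used. *)
Definition embed (R : realType) (d : nat) (l : bool -> 'cV[R]_d)
    (p : nat -> 'cV[R]_d) (x : seq bool) : seq 'cV[R]_d :=
  mkseq (fun i => l (nth false x i) + p i.+1) (size x).

(* The head of the sequence of layers is applied first. *)
Definition transformer_eval (R : realType) (d : nat)
    (As : seq (attention_layer R d)) (s : seq 'cV[R]_d) : seq 'cV[R]_d :=
  foldl (fun t A => layer_eval A t) s As.

(* The dimension is d.+1 so that it is positive. *)
Definition recognizable (R : realType) (C : nat) (L : set (seq bool)) : Prop :=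
  exists (d : nat) (As : C.-tuple (attention_layer R d.+1))
    (l : bool -> 'cV[R]_d.+1) (p : nat -> 'cV[R]_d.+1),
  forall x : seq bool, x != [::] ->
  let g1 := head 0 (transformer_eval As (embed l p x)) in
  (L x -> 0 < g1 ord0 ord0) /\ (~ L x -> g1 ord0 ord0 < 0).

(* The letter 1 is encoded as true. *)
Definition parity : set (seq bool) :=
  fun x => ~~ odd (count_mem true x).

(* Main.v *)
Require Import Defs.
From mathcomp Require Import all_boot all_order all_algebra.
From mathcomp Require Import classical_sets reals topology normedtype sequences exp.
From mathcomp Require Import ring lra zify.

(** Number positions from 0, let n be the length, b the first letter and k the
number of ones among the other letters. Giving position 0 the attention weight
m + 1 and every other position the weight 1 (the score is [j = 0] ln (m + 1)),
position m computes exactly, with the common denominator D = n + m, the values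
(m + 1) / D, k / D and 1 / D. A piecewise linear bump in these is positive for
m = k and zero at every other position, so the uniform average of the bumps
signed by (-1)^m has the sign of (-1)^k, however small it is. The first layer
only separates the first letter from the others, because the first letter would
be counted with weight m + 1; the last network multiplies by (-1)^b. *)

Set Implicit Arguments.
Unset Strict Implicit.
Unset Printing Implicit Defensive.

Import Order.TTheory GRing.Theory Num.Theory.
Local Open Scope ring_scope.

(** * Vectors and matrices given by lists of entries *)

Section SeqMatrix.
Variable R : realType.
Implicit Types (r s t : seq R) (W : seq (seq R)).

(** Lists are padded with zeros, so trailing zeros can be left out and products of concrete matrices
    reduce by computation. *)
Definition cv n s : 'cV[R]_n := \col_i nth 0 s i.

Definition mx m n W : 'M[R]_(m, n) := \matrix_(i, j) nth 0 (nth [::] W i) j.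

Fixpoint sdot r s : R :=
  match r, s with a :: r', b :: s' => a * b + sdot r' s' | _, _ => 0 end.

Fixpoint sadd s t : seq R :=
  match s, t with
  | a :: s', b :: t' => a + b :: sadd s' t'
  | [::], _ => t
  | _, [::] => s
  end.

Lemma nth_sadd s t i : nth 0 (sadd s t) i = nth 0 s i + nth 0 t i.
Proof.
elim: s t i => [|a s IHs] [|b t] [|i] //=; rewrite ?nth_nil ?add0r ?addr0 //.
Qed.

Lemma cvD n s t : cv n s + cv n t = cv n (sadd s t).
Proof. by apply/colP => i; rewrite !mxE nth_sadd. Qed.

Lemma dot_cv n r s : (size s <= n)%N -> dot (cv n r) (cv n s) = sdot r s.
Proof.
rewrite /dot => le_sn.
under eq_bigr do rewrite !mxE.
elim: n r s le_sn => [|n IHn] [|a r] [|b s] //= le_sn; rewrite ?big_ord0 //;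
  try by rewrite big1 // => i _; rewrite ?nth_nil ?(mulr0, mul0r).
by rewrite big_ord_recl IHn.
Qed.

Lemma mulmx_cv m n W s : (size s <= n)%N ->
  mx m n W *m cv n s = cv m [seq sdot r s | r <- W].
Proof.
move=> le_sn; apply/colP => i; rewrite !mxE.
transitivity (dot (cv n (nth [::] W i)) (cv n s)).
  by apply: eq_bigr => j _; rewrite !mxE.
rewrite dot_cv //; have [ltiW|leWi] := ltnP i (size W).
  by rewrite (nth_map [::]).
by rewrite !nth_default ?size_map.
Qed.

Lemma relu_cv n s : relu (cv n s) = cv n [seq Num.max a 0 | a <- s].
Proof.
apply/colP => i; rewrite !mxE; have [ltis|lesi] := ltnP i (size s).
  by rewrite (nth_map 0).
by rewrite !nth_default ?size_map ?maxxx.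
Qed.

End SeqMatrix.

(** * Attention over sequences indexed by position *)

Section AttentionMkseq.
Variables (R : realType) (d : nat).
Implicit Types (A : attention_layer R d) (F : nat -> 'cV[R]_d).

Lemma layer_eval_mkseq A F n : layer_eval A (mkseq F n) =
  mkseq (fun i => net_eval (layer_net A)
    (F i + output_mx A *m attention A (mkseq F n) (F i))) n.
Proof. by rewrite /layer_eval -map_comp. Qed.

Lemma attention_mkseq A F n u : attention A (mkseq F n) u =
  (\sum_(j < n) attention_weight A u (F j))^-1 *:
    \sum_(j < n) attention_weight A u (F j) *: F j.
Proof.
by rewrite /attention /mkseq !big_map -{1 2}[n]subn0 !big_mkord.
Qed.

(** A zero query makes every score 0, hence every weight e^0 = 1. *)
Lemma attention_uniform A F n u : query_mx A = 0 ->
  attention A (mkseq F n) u = n%:R^-1 *: \sum_(j < n) F j.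
Proof.
move=> q0; have w1 v : attention_weight A u v = 1.
  rewrite /attention_weight q0 mul0mx /dot big1 ?expR0 // => k _.
  by rewrite [X in _ * X]mxE mulr0.
rewrite attention_mkseq; under eq_bigr do rewrite w1.
rewrite sumr_const card_ord; congr (_ *: _).
by apply: eq_bigr => j _; rewrite w1 scale1r.
Qed.

End AttentionMkseq.

(** * Piecewise linear gadgets *)

Section Gadgets.
Variable R : realType.
Local Notation pos a := (Num.max (a : R) 0).

(* [u] stands for 1 / D, which is read off position 1 and hence is 0 when
   n = 1; the last summand is nonzero only in that case. *)
Definition bump (b u a : R) : R :=
  pos b - 2 * pos (b - u) + pos (b - 2 * u) + pos (3 * a - 2).

(** This second difference is the tent supported on [0, 2] with peak 1 at z = 1; among the integers
    it is nonzero only at 1, that is, for m = k. *)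
Lemma tent_nat (m k : nat) (z : R := m.+1%:R - k%:R) :
  pos z - 2 * pos (z - 1) + pos (z - 2) = (m == k)%:R.
Proof.
rewrite /z -natr1; case: ltngtP => [ltmk|ltkm|->].
- have : m.+1%:R <= k%:R :> R by rewrite ler_nat.
  by rewrite -natr1 -[false%:R]/(0 : R) => ?; rewrite !max_r; lra.
- have : k.+1%:R <= m%:R :> R by rewrite ler_nat.
  by rewrite -natr1 -[false%:R]/(0 : R) => ?; rewrite !max_l; lra.
- have -> : k%:R + 1 - k%:R = 1 :> R by ring.
  by rewrite -[true%:R]/(1 : R) subrr max_l // maxxx max_r; lra.
Qed.

Lemma bumpE (n m k : nat) : (m < n)%N -> (k < n)%N ->
  let D : R := (n + m)%:R in
  bump (m.+1%:R / D - k%:R / D) ((1 < n)%N%:R / D) (m.+1%:R / D) =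
    (m == k)%:R / D.
Proof.
move=> ltmn ltkn D.
have D0 : 0 < D by rewrite ltr0n; lia.
have posD a : pos (a / D) = pos a / D.
  by rewrite -{1}(mul0r D^-1) maxr_pMl ?invr_ge0 ?ltW.
(* For n = 1 one has a = b = 1 and u = 0: the first three terms of [bump] cancel and the last one is
   1. *)
have [n_gt1|n_le1] := ltnP 1 n; last first.
  have [n1 m0 k0] : [/\ n = 1, m = 0 & k = 0]%N by split; lia.
  have D1 : D = 1 by rewrite /D n1 m0.
  rewrite D1 m0 k0 /bump eqxx !divr1 subr0 mulr0 subr0.
  rewrite (_ : 3 * 1 - 2 = 1); last by ring.
  by rewrite max_l //; ring.
(* As m + 1 <= n and n >= 2, a is at most 2/3, so the last term of [bump] vanishes and the rest is
   the tent divided by D. *)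
have leD : 3 * m.+1%:R <= 2 * D.
  by rewrite -!natrM ler_nat; lia.
rewrite /bump (_ : 3 * _ - 2 = (3 * m.+1%:R - 2 * D) / D); last first.
  by rewrite mulrBl mulfK ?gt_eqF // mulrA.
rewrite -[true%:R]/(1 : R).
have -> : m.+1%:R / D - k%:R / D - 2 * (1 / D) = (m.+1%:R - k%:R - 2) / D.
  by ring.
rewrite -!mulrBl !posD mulrA -mulrBl -!mulrDl; congr (_ / D).
by rewrite [pos (3 * _ - _)]max_r ?subr_le0 // addr0 tent_nat.
Qed.

(* All arguments of the positive parts are at most 3, so [e = 1] kills them. *)
Definition gated_bump (e b u a : R) : R :=
  pos (b - 3 * e) - 2 * pos (b - u - 3 * e)
  + pos (b - 2 * u - 3 * e) + pos (3 * a - 2 - 3 * e).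

Lemma gated_bumpE (e : bool) (b u a : R) : b <= 1 -> 0 <= u -> a <= 1 ->
  gated_bump e%:R b u a = (~~ e)%:R * bump b u a.
Proof.
move=> b1 u0 a1; rewrite /gated_bump /bump; case: e => /=.
  by rewrite mul0r !max_r; lra.
by rewrite ?mulr0 !subr0 mul1r.
Qed.

(** The product (-1)^b s in ReLU form, for a bit b and |s| <= 1: if b = 0, only the first two terms
    survive and give s; if b = 1, only the last two, which give -s. *)
Definition sign_flip (b s : R) : R :=
  pos (s - b) - pos (- s - b) - pos (s + b - 1) + pos (- s + b - 1).

Lemma pos_part_sub (s : R) : pos s - pos (- s) = s.
Proof.
case: (leP 0 s) => ?; last by rewrite [pos (- s)]max_l; lra.
by rewrite [pos (- s)]max_r; lra.
Qed.

Lemma sign_flipE (b : bool) (s : R) : -1 <= s <= 1 ->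
  sign_flip b%:R s = (-1) ^+ b * s.
Proof.
move=> /andP[? ?]; rewrite /sign_flip; case: b => /=.
  rewrite -[true%:R]/(1 : R) !addrK expr1 mulN1r.
  by rewrite -[in RHS](pos_part_sub s)
  [pos (s - 1)]max_r 1?[pos (- s - 1)]max_r; lra.
rewrite -[false%:R]/(0 : R) !subr0 !addr0 expr0 mul1r.
by rewrite -[in RHS](pos_part_sub s)
  [pos (s - 1)]max_r 1?[pos (- s - 1)]max_r; lra.
Qed.

End Gadgets.

(** * The three layers and the recognition of parity *)

Section ParityTransformer.
Variable R : realType.

Definition shallow_net d (W : seq (seq R)) (b : seq R) (V : seq (seq R)) :
    relu_net R d d :=
  NetLayer (mx d d W) (cv d b) (NetAffine (mx d d V) 0).

Lemma shallow_netE d W b V s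
    (h := [seq Num.max a 0 | a <- sadd [seq sdot r s | r <- W] b]) :
  (size s <= d)%N -> (size h <= d)%N ->
  net_eval (shallow_net d W b V) (cv d s) = cv d [seq sdot r h | r <- V].
Proof.
move=> les leh.
by rewrite /= addr0 mulmx_cv // cvD relu_cv mulmx_cv.
Qed.

Definition letter (b : bool) : 'cV[R]_9 := cv 9 [:: b%:R].

(** Here i counts from 1: with m = i - 1, the entries mark m = 0 and m = 1 and hold the score ln (m
    + 1) and the parity of m. Coordinate 0 is left to the letter. *)
Definition position (i : nat) : 'cV[R]_9 :=
  cv 9 [:: 0; (i == 1)%:R; (i == 2)%:R; ln i%:R; (~~ odd i)%:R].

(** The zero output matrix switches attention off. On bits, max(x + y - 1, 0) is conjunction and
    max(x - y, 0) is x and not y; they separate the first letter from the others. The remaining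
    entries are nonnegative and pass ReLU unchanged. *)
Definition layer1 : attention_layer R 9 := AttentionLayer 0 0 0
  (shallow_net 9
    [:: [:: 1; 1]; [:: 1; -1]; [:: 0; 1]; [:: 0; 0; 1]; [:: 0; 0; 0; 1];
        [:: 0; 0; 0; 0; 1]]
    [:: -1]
    [:: [:: 1]; [:: 0; 1]; [:: 0; 0; 1]; [:: 0; 0; 0; 1]; [:: 0; 0; 0; 0; 1];
        [:: 0; 0; 0; 0; 0; 1]]).

Definition hidden1 (x : seq bool) (m : nat) : 'cV[R]_9 :=
  cv 9 [:: ((m == 0) && nth false x m)%:R; ((m != 0) && nth false x m)%:R;
           (m == 0)%:R; (m == 1)%:R; ln m.+1%:R; (odd m)%:R].

Lemma layer1E x :
  layer_eval layer1 (embed letter position x) = mkseq (hidden1 x) (size x).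
Proof.
rewrite /embed layer_eval_mkseq; apply: eq_mkseq => m; cbv beta.
rewrite [output_mx layer1]/= mul0mx addr0 cvD [layer_net _]/= shallow_netE //=.
have ln0 : 0 <= ln m.+1%:R :> R by rewrite ln_ge0 // ler1n.
rewrite negbK !eqSS ?addr0 ?mul0r ?mul1r ?add0r ?mulN1r ?addr0.
rewrite [Num.max (ln _) 0]max_l // !(max_l (ler0n _ _)).
by congr (cv 9 [:: _, _ & _]); case: (m == 0%N); case: nth => /=;
  rewrite maxEle; case: ifP; lra.
Qed.

(* At position m the network receives the six entries of [hidden1] followed by
   (m + 1 - k) / D, [n > 1] / D and (m + 1) / D. *)
Definition layer2 : attention_layer R 9 := AttentionLayer
  (mx 9 9 [:: [:: 0; 0; 1]])
  (mx 9 9 [:: [:: 0; 0; 0; 0; 1]])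
  (mx 9 9 [:: [::]; [::]; [::]; [::]; [::]; [::];
    [:: 0; -1; 1]; [:: 0; 0; 0; 1]; [:: 0; 0; 1]])
  (shallow_net 9
    [:: [:: 1];
      [:: 0; 0; 0; 0; 0; -3; 1]; [:: 0; 0; 0; 0; 0; -3; 1; -1];
      [:: 0; 0; 0; 0; 0; -3; 1; -2]; [:: 0; 0; 0; 0; 0; -3; 0; 0; 3];
      [:: 0; 0; 0; 0; 0; 3; 1]; [:: 0; 0; 0; 0; 0; 3; 1; -1];
      [:: 0; 0; 0; 0; 0; 3; 1; -2]; [:: 0; 0; 0; 0; 0; 3; 0; 0; 3]]
    [:: 0; 0; 0; 0; -2; -3; -3; -3; -5]
    [:: [:: 1]; [:: 0; 1; -2; 1; 1; -1; 2; -1; -1]]).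

(** Here [x] is the word without its first letter [b], so n is [(size x).+1]. Entry 0 keeps [b] at
    position 0 for the last layer. *)
Definition hidden2 (b : bool) (x : seq bool) (m : nat) : 'cV[R]_9 :=
  cv 9 [:: ((m == 0) && b)%:R;
    (m == count_mem true x)%:R * (-1) ^+ m / ((size x).+1 + m)%:R].

(** The key carries [j = 0] and the query ln (m + 1) in the same coordinate; the total weight is (m
    + 1) + (n - 1) = n + m. *)
Lemma attention2E b x m :
  attention layer2 (mkseq (hidden1 (b :: x)) (size x).+1) (hidden1 (b :: x) m) =
  ((size x).+1 + m)%:R^-1 *: (m.+1%:R *: hidden1 (b :: x) 0 +
    \sum_(j < size x) hidden1 (b :: x) j.+1).
Proof.
have w j : attention_weight layer2 (hidden1 (b :: x) m) (hidden1 (b :: x) j) =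
    if j == 0%N then m.+1%:R else 1.
  rewrite /attention_weight !mulmx_cv // dot_cv //=.
  rewrite ?(mul0r, add0r, addr0, mul1r).
  by case: j => [|j] /=; rewrite ?mul1r ?mul0r ?expR0 ?lnK ?posrE.
rewrite attention_mkseq; congr (_^-1 *: _).
  under eq_bigr do rewrite w.
  by rewrite big_ord_recl /= sumr_const card_ord -natrD; congr _%:R; lia.
under eq_bigr do rewrite w.
rewrite big_ord_recl /=; congr (_ + _).
by apply: eq_bigr => j _; rewrite scale1r.
Qed.

Lemma sum_nth_count (x : seq bool) :
  \sum_(j < size x) (nth false x j)%:R = (count_mem true x)%:R :> R.
Proof.
elim: x => [|b x IHx]; first by rewrite big_ord0.
by rewrite big_ord_recl /= IHx natrD; case: b.
Qed.

(** The averages go to coordinates 6 to 8, which are zero in [hidden1], so the residual sum leaves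
    all entries intact. *)
Lemma output2E b x m (D : R := ((size x).+1 + m)%:R) :
  output_mx layer2 *m
    attention layer2 (mkseq (hidden1 (b :: x)) (size x).+1) (hidden1 (b :: x) m)
  = cv 9 [:: 0; 0; 0; 0; 0; 0; m.+1%:R / D - (count_mem true x)%:R / D;
          (0 < size x)%N%:R / D; m.+1%:R / D].
Proof.
have O0 : output_mx layer2 *m hidden1 (b :: x) 0 =
    cv 9 [:: 0; 0; 0; 0; 0; 0; 1; 0; 1].
  by rewrite mulmx_cv //= ?(mul0r, add0r, addr0, mul1r, mulr0, mulN1r, oppr0).
have OS j : output_mx layer2 *m hidden1 (b :: x) j.+1 =
    cv 9 [:: 0; 0; 0; 0; 0; 0; - (nth false x j)%:R; (j == 0)%:R; 0].
  by rewrite mulmx_cv //= ?(mul0r, add0r, addr0, mul1r, mulr0, mulN1r, oppr0).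
rewrite attention2E -scalemxAr mulmxDr -scalemxAr mulmx_sumr O0.
under eq_bigr do rewrite OS.
apply/colP => -[i lti]; rewrite !mxE summxE.
under eq_bigr do rewrite mxE.
do 9?[case: i lti => [|i] lti /=] => //; rewrite -/D mulrC.
1-6: by rewrite mulr0 big1_eq addr0 mul0r.
- by rewrite mulr1 sumrN sum_nth_count mulrBl.
- rewrite mulr0 add0r; case: (size x) => [|n]; first by rewrite big_ord0.
  by rewrite big_ord_recl big1_eq addr0.
- by rewrite mulr1 big1_eq addr0.
Qed.

(** One group of four hidden units is open for e = 0, the other for e = 1, so their difference gives
    the bump the sign (-1)^e. *)
Lemma net2E (x1 y f g l e b u a : R) : 0 <= x1 ->
  net_eval (layer_net layer2) (cv 9 [:: x1; y; f; g; l; e; b; u; a]) =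
  cv 9 [:: x1; gated_bump e b u a - gated_bump (1 - e) b u a].
Proof.
move=> x1_ge0; rewrite [layer_net _]/= shallow_netE //=.
rewrite ?(mul0r, add0r, addr0, mul1r, mulN1r) max_l //.
congr (cv 9 [:: _; _]); rewrite /gated_bump.
have -> : -3 * e + b = b - 3 * e by ring.
have -> : -3 * e + (b - u) = b - u - 3 * e by ring.
have -> : -3 * e + (b + -2 * u) = b - 2 * u - 3 * e by ring.
have -> : -3 * e + 3 * a - 2 = 3 * a - 2 - 3 * e by ring.
have -> : 3 * e + b - 3 = b - 3 * (1 - e) by ring.
have -> : 3 * e + (b - u) - 3 = b - u - 3 * (1 - e) by ring.
have -> : 3 * e + (b + -2 * u) - 3 = b - 2 * u - 3 * (1 - e) by ring.
have -> : 3 * e + 3 * a - 5 = 3 * a - 2 - 3 * (1 - e) by ring.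
by ring.
Qed.

Lemma layer2E b x :
  layer_eval layer2 (mkseq (hidden1 (b :: x)) (size x).+1) =
  mkseq (hidden2 b x) (size x).+1.
Proof.
rewrite layer_eval_mkseq; apply/eq_in_map => m.
rewrite mem_iota add0n => /andP[_ ltmn]; cbv beta.
rewrite output2E cvD [sadd _ _]/= ?(add0r, addr0) net2E ?ler0n //.
set k := count_mem true x.
(* Only n - 1 letters are counted in k, so a position numbered k exists. *)
have ltkn : (k < (size x).+1)%N by rewrite ltnS count_size.
have D_gt0 : 0 < ((size x).+1 + m)%:R :> R by rewrite ltr0n.
have a_le1 : m.+1%:R / ((size x).+1 + m)%:R <= 1 :> R.
  by rewrite ler_pdivrMr // mul1r ler_nat; lia.
have k_ge0 : 0 <= k%:R / ((size x).+1 + m)%:R :> R.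
  by rewrite divr_ge0 ?ler0n.
have -> : 1 - (odd m)%:R = (~~ odd m)%:R :> R.
  by case: odd; rewrite ?subrr ?subr0.
have b_le1 : m.+1%:R / ((size x).+1 + m)%:R
    - k%:R / ((size x).+1 + m)%:R <= 1 :> R by lra.
rewrite !gated_bumpE ?divr_ge0 ?ler0n //.
(* [ltnS] turns the flag [0 < n - 1] into the [1 < n] of [bumpE]. *)
rewrite -ltnS bumpE // negbK -mulrBl /hidden2 -/k.
congr (cv 9 [:: _; _]); first by case: (m).
rewrite -signr_odd mulrA [_ * (-1) ^+ _]mulrC; congr (_ * _ / _).
by case: odd; rewrite ?subr0 ?sub0r.
Qed.

Definition layer3 : attention_layer R 9 := AttentionLayer
  0 0 (mx 9 9 [:: [::]; [::]; [:: 0; 1]])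
  (shallow_net 9 [:: [:: -1; 0; 1]; [:: -1; 0; -1]; [:: 1; 0; 1]; [:: 1; 0; -1]]
    [:: 0; 0; -1; -1] [:: [:: 1; -1; -1; 1]]).

Lemma net3E (b t s : R) :
  net_eval (layer_net layer3) (cv 9 [:: b; t; s]) = cv 9 [:: sign_flip b s].
Proof.
rewrite [layer_net _]/= shallow_netE //=.
rewrite ?(mul0r, add0r, addr0, mul1r, mulN1r) /sign_flip.
have -> : - b + s = s - b by ring.
have -> : - b - s = - s - b by ring.
have -> : b + s - 1 = s + b - 1 by ring.
have -> : b - s - 1 = - s + b - 1 by ring.
by congr (cv 9 [:: _]); ring.
Qed.

(** Only the summand at position k survives: its bump supplies 1 / (n + k) and the averaging 1 / n.
    The result goes to a fresh coordinate, apart from the bump of position 0 itself. *)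
Lemma output3E b x : output_mx layer3 *m
    attention layer3 (mkseq (hidden2 b x) (size x).+1) (hidden2 b x 0) =
  cv 9 [:: 0; 0; (-1) ^+ count_mem true x /
    ((size x).+1%:R * ((size x).+1 + count_mem true x)%:R)].
Proof.
have Oh j : output_mx layer3 *m hidden2 b x j = cv 9 [:: 0; 0;
    (j == count_mem true x)%:R * (-1) ^+ j / ((size x).+1 + j)%:R].
  by rewrite mulmx_cv //= ?(mul0r, add0r, addr0, mul1r).
rewrite attention_uniform // -scalemxAr mulmx_sumr.
under eq_bigr do rewrite Oh.
apply/colP => -[i lti]; rewrite !mxE summxE.
under eq_bigr do rewrite mxE.
have ltk : (count_mem true x < (size x).+1)%N by rewrite ltnS count_size.
case: i lti => [|[|[|i]]] _ /=; rewrite ?nth_nil ?big1_eq ?mulr0 //.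
rewrite (bigD1 (Ordinal ltk)) //= eqxx mul1r big1 ?addr0 => [|j].
  by rewrite mulrC invfM -!mulrA [_^-1 / _]mulrC.
by rewrite -val_eqE /= => /negPf->; rewrite !mul0r.
Qed.

Lemma transformer_eval3 d (A B C : attention_layer R d) s :
  transformer_eval [tuple A; B; C] s =
  layer_eval C (layer_eval B (layer_eval A s)).
Proof. by []. Qed.

End ParityTransformer.

Theorem theorem1 (R : realType) : recognizable R 3 parity.
Proof.
(* The dimension is 9: the second network reads six old and three new entries and has nine hidden
   units. *)
exists 8%N, [tuple layer1 R; layer2 R; layer3 R], (@letter R), (@position R).
case=> [//|b x] _; rewrite transformer_eval3 layer1E layer2E layer_eval_mkseq.
set F := fun i => _; set k := count_mem true x.
set N : R := (size x).+1%:R * ((size x).+1 + k)%:R.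
have N_gt0 : 0 < N by rewrite mulr_gt0 ?ltr0n.
(* This gives |s| = 1 / N <= 1, the range in which [sign_flip] is exact. *)
have N_ge1 : 1 <= N by rewrite /N -natrM ler1n muln_gt0.
have sE : (F 0%N) ord0 ord0 = (-1) ^+ (b + k) / N.
  rewrite /F output3E -/k -/N cvD [sadd _ _]/= !addr0 net3E mxE /=.
  rewrite sign_flipE ?exprD ?mulrA //.
  rewrite -ler_norml normrM normrX normrN1 expr1n mul1r ger0_norm
    ?invr_ge0 ?(ltW N_gt0) //.
  by rewrite invf_le1.
cbv zeta; rewrite [head _ _](_ : _ = F 0%N) // sE.
rewrite /parity [count_mem _ _]/= -/k.
(* The word has b + k ones in all, and the sign (-1)^(b + k) depends only on the parity of this
   number. *)
rewrite -signr_odd eqb_id; split => [/negPf-> | /negP/negPn->].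
  by rewrite expr0 mul1r invr_gt0.
by rewrite expr1 mulN1r oppr_lt0 invr_gt0.
Qed.
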